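(* Let $y_D$ be a real random variable with continuous cumulative distribution function $F$, let $\gamma\in[0.5,1)\cap\mathbb{Q}$ with irreducible fraction $\gamma=\frac{n_1}{n_2}$, and let $\epsilon\in(0,1)$, $\rho\in(0,1)$. Let $z_{\rho/2}$ denote the upper $\frac{\rho}{2}$-quantile of the standard Gaussian distribution. Set $$k=\left\lceil\left(\frac{z_{\rho/2}\sqrt{\gamma-\gamma^2}}{2\epsilon\sqrt{n_2}}+\sqrt{\left(\frac{z_{\rho/2}\sqrt{\gamma-\gamma^2}}{2\epsilon\sqrt{n_2}}\right)^2+\frac{2(\gamma-0.5)z_{\rho/2}^2}{3n_2\epsilon}+\frac{1+\gamma}{3n_2\epsilon}}\right)^2\right\rceil,\qquad N=kn_2,$$ let $y_{D,1},\dots,y_{D,N}$ be i.i.d. copies of $y_D$ with order statistics $y_{D,(1)}\le\dots\le y_{D,(N)}$, and let $\tilde J_D=y_{D,(N\gamma)}$. Assume the following confidence-interval hypothesis for $X\sim\mathrm{Beta}(N\gamma,N+1-N\gamma)$: $$\mathrm{prob}\{\gamma-\epsilon_l\le X\le \gamma+\epsilon_u\}\ge 1-\rho,$$ where $$\epsilon_u=\frac{\sqrt{\gamma-\gamma^2}}{\sqrt N}z_{\rho/2}+\frac{2(0.5-\gamma)z_{\rho/2}^2-1-\gamma}{3N},\qquad \epsilon_l=\frac{\sqrt{\gamma-\gamma^2}}{\sqrt N}z_{\rho/2}-\frac{2(0.5-\gamma)z_{\rho/2}^2-1-\gamma}{3N}.$$ Then $$\mathrm{prob}\{|F(\tilde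 J_D)-\gamma|\le\epsilon\}\ge 1-\rho .$$
   Context: For a finite sample $\{x_i\}_{i=1}^N$, the order statistics $x_{(1)}\le\dots\le x_{(N)}$ are the sample values sorted increasingly. The irreducible fraction of a rational $\gamma$ is $\gamma=n_1/n_2$ with $n_1,n_2$ coprime positive integers. Known fact that may be used: if $y_{D,(m)}$ is the $m$th order statistic of $N$ i.i.d. samples with continuous CDF $F$, then $F(y_{D,(m)})\sim\mathrm{Beta}(m,N+1-m)$. In the paper, the confidence-interval hypothesis on the Beta variable is taken from an asymptotic (normal-approximation) result valid up to terms of order $N^{-3/2}$; here it is stated as an explicit assumption. *)

(* Defs.v *)
From HB Require Import structures.
From mathcomp Require Import all_boot all_order all_algebra.
From mathcomp Require Import all_classical all_reals all_analysis.
Set Implicit Arguments. Unset Strict Implicit. Unset Printing Implicit Defensive.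
Import Order.TTheory GRing.Theory Num.Theory.
Import numFieldNormedType.Exports.
Local Open Scope classical_set_scope.
Local Open Scope ring_scope.

Definition mutually_independent d (T : measurableType d) (R : realType)
  (P : probability T R) (N : nat) (X : 'I_N -> {RV P >-> R}) : Prop :=
  forall (I : {set 'I_N}) (B : 'I_N -> set R),
    (forall i, measurable (B i)) ->
    P (\bigcap_(i in [set j | j \in I]) (X i @^-1` B i)) =
    (\prod_(i in I) P (X i @^-1` B i))%E.

(* m-th order statistic (1-based) of the sample (X_1 w, ..., X_N w). *)
Definition order_stat d (T : measurableType d) (R : realType)
  (P : probability T R) (N : nat) (X : 'I_N -> {RV P >-> R}) (m : nat)
  (w : T) : R :=
  nth 0 (sort <=%R [seq X i w | i <- enum 'I_N]) m.-1.

Definition k_real (R : realType) (gamma eps z : R) (n2 : nat) : R :=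
  let a := z * Num.sqrt (gamma - gamma ^+ 2) / (2 * eps * Num.sqrt n2%:R) in
  (a + Num.sqrt (a ^+ 2 + 2 * (gamma - 2^-1) * z ^+ 2 / (3 * n2%:R * eps)
                 + (1 + gamma) / (3 * n2%:R * eps))) ^+ 2.

Definition eps_u (R : realType) (gamma z : R) (N : nat) : R :=
  Num.sqrt (gamma - gamma ^+ 2) / Num.sqrt N%:R * z
  + (2 * (2^-1 - gamma) * z ^+ 2 - 1 - gamma) / (3 * N%:R).

Definition eps_l (R : realType) (gamma z : R) (N : nat) : R :=
  Num.sqrt (gamma - gamma ^+ 2) / Num.sqrt N%:R * z
  - (2 * (2^-1 - gamma) * z ^+ 2 - 1 - gamma) / (3 * N%:R).

(* Main.v *)
Require Import Defs.
From HB Require Import structures.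
From mathcomp Require Import all_boot all_order all_algebra.
From mathcomp Require Import all_classical all_reals all_analysis.
Import Order.TTheory GRing.Theory Num.Theory.
Import numFieldNormedType.Exports.
Local Open Scope classical_set_scope.
Local Open Scope ring_scope.
From mathcomp Require Import ring lra.

(* Write g = n1/n2, N = k n2 and D = 1 + g + 2 (g - 1/2) z^2,
   which is positive because g >= 1/2.  Then
     eps_u = sqrt(g - g^2) z / sqrt N - D / (3N),
     eps_l = sqrt(g - g^2) z / sqrt N + D / (3N),
   so eps_u <= eps_l.  With a = z sqrt(g - g^2) / (2 eps sqrt n2) the number
   inside the ceiling is (a + sqrt(a^2 + D / (3 n2 eps)))^2, and k was chosen
   so that t = sqrt k dominates a + sqrt(a^2 + D/(3 n2 eps)); an elementary
   quadratic inequality in t then yields eps_l <= eps.  Hence the confidence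
   interval [g - eps_l, g + eps_u] lies inside [g - eps, g + eps], and the
   theorem follows from the Beta law of F(y_(N g)), the confidence-interval
   hypothesis and monotonicity of the Beta measure.  Continuity of F, independence and
   identical distribution of the sample enter only through the assumed Beta
   law of F(y_(N g)). *)

Definition ci_shift {R : realFieldType} (gamma z : R) : R :=
  1 + gamma + 2 * (gamma - 2^-1) * z ^+ 2.

Lemma ci_shift_gt0 (R : realFieldType) (gamma z : R) :
  2^-1 <= gamma -> 0 < ci_shift gamma z.
Proof. by move=> hg; rewrite /ci_shift; have := sqr_ge0 z; nra. Qed.

Lemma ci_shiftE (R : realFieldType) (gamma z : R) :
  2 * (2^-1 - gamma) * z ^+ 2 - 1 - gamma = - ci_shift gamma z.
Proof. by rewrite /ci_shift; ring. Qed.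

Lemma eps_u_le_eps_l (R : realType) (gamma z : R) (N : nat) :
  2^-1 <= gamma -> (0 < N)%N -> eps_u gamma z N <= eps_l gamma z N.
Proof.
move=> hg hN; rewrite /eps_u /eps_l lerD2l ci_shiftE mulNr opprK.
have : 0 < ci_shift gamma z / (3 * N%:R).
  by rewrite divr_gt0 ?ci_shift_gt0 // mulr_gt0 ?ltr0n.
lra.
Qed.

(* The quadratic inequality behind the choice of k: if t >= a + q with
   q = sqrt(a^2 + D/(3 u^2 eps)), a = z s/(2 eps u), then the half-width
   s z/(t u) + D/(3 t^2 u^2) of a sample of size (t u)^2 is at most eps. *)
Lemma half_width_le {R : realFieldType} {s z eps u t q D : R} :
  0 < eps -> 0 < u -> 0 < t -> 0 <= q ->
  q ^+ 2 = (z * s / (2 * eps * u)) ^+ 2 + D / (3 * u ^+ 2 * eps) ->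
  z * s / (2 * eps * u) + q <= t ->
  s / (t * u) * z + D / (3 * (t ^+ 2 * u ^+ 2)) <= eps.
Proof.
move=> he hu ht hq.
set a := z * s / (2 * eps * u) => hqa hat.
have hzs : z * s = a * (2 * eps * u).
  by rewrite /a mulfVK // !mulf_neq0 ?gt_eqF.
have hD : D = (q ^+ 2 - a ^+ 2) * (3 * u ^+ 2 * eps).
  by rewrite hqa addrAC subrr add0r mulfVK // !mulf_neq0 ?gt_eqF ?expf_neq0 ?gt_eqF.
have -> : s / (t * u) * z + D / (3 * (t ^+ 2 * u ^+ 2)) =
          (a * 2 * eps * t + (q ^+ 2 - a ^+ 2) * eps) / t ^+ 2.
  rewrite hD mulrAC (mulrC s) hzs.
  by field; rewrite ?mulf_neq0 ?gt_eqF ?expf_neq0 ?gt_eqF.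
rewrite ler_pdivrMr ?exprn_gt0 //.
have hqt : q ^+ 2 <= (t - a) ^+ 2 by rewrite ler_sqr ?nnegrE //; lra.
nra.
Qed.

Section SampleSize.
Context {R : realType} {gamma eps z : R} {n2 : nat}.
Hypotheses (hgam : 2^-1 <= gamma) (heps : 0 < eps) (hn2 : (0 < n2)%N).

Let u : R := Num.sqrt n2%:R.
Let a : R := z * Num.sqrt (gamma - gamma ^+ 2) / (2 * eps * u).
Let b : R := a ^+ 2 + ci_shift gamma z / (3 * u ^+ 2 * eps).

Let u_gt0 : 0 < u. Proof. by rewrite sqrtr_gt0 ltr0n. Qed.
Let u_sqr : u ^+ 2 = n2%:R. Proof. by rewrite sqr_sqrtr ?ler0n. Qed.

Lemma k_realE : k_real gamma eps z n2 = (a + Num.sqrt b) ^+ 2.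
Proof.
rewrite /k_real -/u -/a /b; congr ((_ + Num.sqrt _) ^+ 2).
by rewrite u_sqr /ci_shift; field; rewrite ?mulf_neq0 ?gt_eqF ?ltr0n.
Qed.

(* The root a + sqrt b is positive since b > a^2. *)
Lemma k_root_gt0 : 0 < a + Num.sqrt b.
Proof.
have hpos : 0 < ci_shift gamma z / (3 * u ^+ 2 * eps).
  by rewrite divr_gt0 ?ci_shift_gt0 // !mulr_gt0 // exprn_gt0.
have : a ^+ 2 < Num.sqrt b ^+ 2.
  by rewrite sqr_sqrtr ?ltrDl // /b addr_ge0 ?sqr_ge0 // ltW.
have := sqrtr_ge0 b; nra.
Qed.

Lemma k_gt0 {k : nat} : k_real gamma eps z n2 <= k%:R -> (0 < k)%N.
Proof.
move=> hk; rewrite -(ltr0n R); apply: lt_le_trans hk.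
by rewrite k_realE exprn_gt0 ?k_root_gt0.
Qed.

Lemma eps_l_le {k : nat} :
  k_real gamma eps z n2 <= k%:R -> eps_l gamma z (k * n2) <= eps.
Proof.
move=> hk.
have ht : a + Num.sqrt b <= Num.sqrt k%:R.
  by move: (ler_wsqrtr hk); rewrite k_realE sqrtr_sqr ger0_norm // ltW ?k_root_gt0.
have ht0 : 0 < Num.sqrt (k%:R : R) := lt_le_trans k_root_gt0 ht.
have hsN : Num.sqrt (k * n2)%:R = Num.sqrt k%:R * u.
  by rewrite natrM sqrtrM ?ler0n.
have hN : (k * n2)%:R = Num.sqrt (k%:R : R) ^+ 2 * u ^+ 2.
  by rewrite u_sqr sqr_sqrtr ?ler0n // natrM.
rewrite /eps_l ci_shiftE mulNr opprK hsN hN.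
have hb : Num.sqrt b ^+ 2 = a ^+ 2 + ci_shift gamma z / (3 * u ^+ 2 * eps).
  by rewrite sqr_sqrtr // addr_ge0 ?sqr_ge0 // ltW // divr_gt0 ?ci_shift_gt0
    // !mulr_gt0 // exprn_gt0.
exact: (half_width_le heps u_gt0 ht0 (sqrtr_ge0 b) hb ht).
Qed.

End SampleSize.

Lemma ci_subset (R : realType) (gamma el eu eps : R) :
  el <= eps -> eu <= eps ->
  `[gamma - el, gamma + eu] `<=` `[gamma - eps, gamma + eps].
Proof.
move=> hl hu x /=; rewrite !in_itv /= => /andP[h1 h2].
by apply/andP; split; lra.
Qed.

Theorem theorem2
  (R : realType) (d : measure_display) (T : measurableType d)
  (P : probability T R)
  (yD : {RV P >-> R}) (F : R -> R)
  (hF : forall r, (F r)%:E = cdf yD r)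
  (hFcont : continuous F)
  (n1 n2 : nat) (hn2 : (0 < n2)%N) (hcop : coprime n1 n2)
  (hgam : 2^-1 <= n1%:R / n2%:R :> R) (hgam1 : n1%:R / n2%:R < 1 :> R)
  (eps rho z : R)
  (heps : 0 < eps < 1) (hrho : 0 < rho < 1)
  (hz : normal_prob 0 1 `]z, +oo[ = (rho / 2)%:E)
  (k : nat)
  (hk : (k : int) = Num.ceil (k_real (n1%:R / n2%:R) eps z n2))
  (y : 'I_(k * n2) -> {RV P >-> R})
  (hiid : mutually_independent y)
  (hident : forall i (A : set R), measurable A ->
       distribution P (y i) A = distribution P yD A)
  (* known fact: F(y_(m)) ~ Beta(m, N+1-m), here with m = N*gamma = k*n1 *)
  (hbeta : forall A : set R, measurable A ->
       P [set w | F (order_stat y (k * n1) w) \in A]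
       = beta_prob (k * n1) (k * n2 + 1 - k * n1) A)
  (* confidence-interval hypothesis on X ~ Beta(N*gamma, N+1-N*gamma) *)
  (hCI : ((1 - rho)%:E <=
       beta_prob (k * n1) (k * n2 + 1 - k * n1)
         `[(n1%:R / n2%:R - eps_l (n1%:R / n2%:R) z (k * n2))%R,
           (n1%:R / n2%:R + eps_u (n1%:R / n2%:R) z (k * n2))%R])%E) :
  ((1 - rho)%:E <=
     P [set w | (`|F (order_stat y (k * n1) w) - n1%:R / n2%:R| <= eps)%R])%E.
Proof.
set g := n1%:R / n2%:R in hgam hk hCI *.
have [eps_gt0 _] := andP heps.
have hkr : k_real g eps z n2 <= k%:R by rewrite -[k%:R]/((k : int)%:~R) hk ceil_ge.
have hl : eps_l g z (k * n2) <= eps := eps_l_le hgam eps_gt0 hn2 hkr.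
have hu : eps_u g z (k * n2) <= eps.
  apply: le_trans hl; apply: eps_u_le_eps_l => //.
  by rewrite muln_gt0 hn2 (k_gt0 hgam eps_gt0 hn2 hkr).
have -> : [set w | `|F (order_stat y (k * n1) w) - g| <= eps] =
          [set w | F (order_stat y (k * n1) w) \in `[g - eps, g + eps]%classic].
  by apply: eq_set => w; rewrite in_setE /= in_itv /= ler_distl.
rewrite hbeta; last exact: measurable_itv.
apply: (le_trans hCI); apply: le_measure.
- by rewrite inE; exact: measurable_itv.
- by rewrite inE; exact: measurable_itv.
exact: ci_subset.
Qed.
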